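(* Let $N=1$, $p\in[1,\infty]$, let $u_0\in L^1(\mathbb{R})$ be nonnegative and nontrivial, $u$ the mild solution and $M=\int u_0$. Let $g:(0,\infty)\to(0,\infty)$ satisfy $g(t)\to\infty$ and $g(t)/t^{\alpha/2}\to0$ as $t\to\infty$, and let $0<\nu<\mu<\infty$. Then $$(g(t))^{-\frac1p}\big\|t^{\frac\alpha2}u(\cdot,t)-MF(0)\big\|_{L^p(\{\nu<|x|/g(t)<\mu\})}\to0\quad\text{as }t\to\infty.$$
   Context: Fix $N\ge1$ and $\alpha\in(0,1)$. Let $\mathbb{E}_\alpha(s)=\sum_{k\ge0}s^k/\Gamma(1+k\alpha)$ be the Mittag-Leffler function. The fundamental solution of the time-fractional heat equation $\partial_t^\alpha u=\Delta u$ (where $\partial_t^\alpha$ is the Caputo derivative $\partial_t^\alpha u(x,t)=\frac{1}{\Gamma(1-\alpha)}\partial_t\int_0^t\frac{u(x,\tau)-u(x,0)}{(t-\tau)^\alpha}\,d\tau$) is the function $Z$ on $\mathbb{R}^N\times(0,\infty)$ whose Fourier transform in $x$ is $\widehat Z(\omega,t)=\mathbb{E}_\alpha(-|\omega|^2t^\alpha)$. It has the self-similar form $Z(x,t)=t^{-\alpha N/2}F(xt^{-\alpha/2})$ with a positive radially symmetric profile $F$, smooth on $\mathbb{R}^N\setminus\{0\}$, $\int F=1$; when $N=1$, $F$ is bounded and continuous on $\mathbb{R}$ (so $F(0)$ is defined). For nonnegative nontrivial $u_0\in L^1(\mathbb{R}^N)$ the (mild) solution of $\partial_t^\alpha u=\Delta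 u$ in $\mathbb{R}^N\times(0,\infty)$, $u(\cdot,0)=u_0$, is $u(x,t)=\int_{\mathbb{R}^N}Z(x-y,t)u_0(y)\,dy$. *)

(* Defs.v *)
From HB Require Import structures.
From mathcomp Require Import all_boot all_order all_algebra.
From mathcomp Require Import all_classical all_reals all_analysis.
Set Implicit Arguments. Unset Strict Implicit. Unset Printing Implicit Defensive.
Import Order.TTheory GRing.Theory Num.Theory.
Import numFieldNormedType.Exports.
Local Open Scope classical_set_scope.
Local Open Scope ring_scope.

Definition Gamma (R : realType) (s : R) : R :=
  \int[(@lebesgue_measure R)]_(x in `]0, +oo[) (x `^ (s - 1) * expR (- x)).

Definition mittag_leffler (R : realType) (a s : R) : R :=
  limn (fun n => \sum_(k < n) s ^+ k / Gamma (1 + k%:R * a)).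

(* Fundamental solution for N = 1: inverse Fourier transform of
   omega |-> E_a(-|omega|^2 t^a), i.e.
   Z(x,t) = (2 pi)^-1 \int_R E_a(-omega^2 t^a) e^{i omega x} d omega
          = (2 pi)^-1 \int_R E_a(-omega^2 t^a) cos(omega x) d omega
   (the sine part vanishes by evenness; the integral converges absolutely). *)
Definition fundZ (R : realType) (a x t : R) : R :=
  (2 * pi)^-1 * \int[(@lebesgue_measure R)]_(w in [set: R])
     (mittag_leffler a (- (w ^+ 2 * t `^ a)) * cos (w * x)).

Definition profileF (R : realType) (a y : R) : R := fundZ a y 1.

Definition mild_sol (R : realType) (a : R) (u0 : R -> R) (x t : R) : R :=
  \int[(@lebesgue_measure R)]_(y in [set: R]) (fundZ a (x - y) t * u0 y).

(* the prefactor (g)^(-1/p), with the convention 1/oo = 0 *)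
Definition inv_p_pow (R : realType) (g : R) (p : \bar R) : R :=
  match p with
  | r%:E => g `^ (- r^-1)
  | _ => 1
  end.

Definition LpNormOn (R : realType) (p : \bar R) (A : set R) (f : R -> R) : \bar R :=
  Lnorm (@lebesgue_measure R) p (fun x => (\1_A x * f x)%:E).

(* Main.v *)
Require Import Defs.
From HB Require Import structures.
From mathcomp Require Import all_boot all_order all_algebra.
From mathcomp Require Import all_classical all_reals all_analysis.
From mathcomp Require Import measurable_realfun ess_sup_inf ring lra.
Import Order.TTheory GRing.Theory Num.Theory.
Import numFieldNormedType.Exports.
Local Open Scope classical_set_scope.
Local Open Scope ring_scope.
Set Implicit Arguments. Unset Strict Implicit. Unset Printing Implicit Defensive.

(* As Z(x, t) = c^-1 F(x / c) with c = t^(a/2), one has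
   c u(x, t) - M F(0) = \int (F((x - y) / c) - F(0)) u0(y) dy.  If F is bounded
   and continuous at 0, this is small uniformly for |x| <= mu g(t) = o(c): split
   at |y| = L.  The L^p norm over a set of measure at most 2 mu g(t) follows.

   F is bounded and continuous once w |-> E_a(-w^2) is integrable, and this comes
   from 0 <= E_a(-s) <= 1 / (1 + s / Gamma(1 + a)) for s >= 0.  These bounds are
   obtained from the Grunwald-Letnikov discretisation of the relaxation equation:
   let u_n be the coefficient of z^n in
     (1 - z)^-1 / (1 + l (1 - z)^-a) = \sum_j (-l)^j (1 - z)^-(1 + j a).
   Since (1 - z)^a has nonpositive coefficients after the first, u_n >= 0 and u_n
   is nonincreasing in n, whence u_n (1 + l [z^n] (1 - z)^-(1 + a)) <= 1.  For
   l = s n^-a and n -> oo, Gauss's formula [z^n] (1 - z)^-(1 + x) ~ n^x / Gamma(1 + x)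
   and dominated convergence of the series give u_n -> E_a(-s). *)

(** * The coefficients of (1 - z)^(-x) *)

(* The coefficient of z^n in (1 - z)^(-x). *)
Definition rbin {R : realType} (n : nat) (x : R) : R :=
  \prod_(i < n) ((x + i%:R) / i.+1%:R).

Lemma rbin0 (R : realType) (x : R) : rbin 0 x = 1.
Proof. by rewrite /rbin big_ord0. Qed.

Lemma rbinS (R : realType) n (x : R) :
  rbin n.+1 x = rbin n x * ((x + n%:R) / n.+1%:R).
Proof. by rewrite /rbin big_ord_recr. Qed.

Lemma mul_rbinS (R : realType) n (x : R) :
  n.+1%:R * rbin n.+1 x = (x + n%:R) * rbin n x.
Proof.
rewrite rbinS mulrCA [X in _ * X]mulrC divfK ?pnatr_eq0//.
by rewrite mulrC.
Qed.

Lemma rbin_ge0 (R : realType) n (x : R) : 0 <= x -> 0 <= rbin n x.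
Proof.
by move=> x0; apply: prodr_ge0 => i _; rewrite divr_ge0// addr_ge0.
Qed.

Lemma ler_rbin (R : realType) n (x y : R) :
  0 <= x -> x <= y -> rbin n x <= rbin n y.
Proof.
move=> x0 xy; apply: ler_prod => i _.
by rewrite divr_ge0 ?addr_ge0//= ler_wpM2r ?invr_ge0// lerD2r.
Qed.

(** The factor with i = 0 is - x, and all later factors are nonnegative because x <= 1. *)
Lemma rbinN_le0 (R : realType) n (x : R) : 0 <= x <= 1 -> rbin n.+1 (- x) <= 0.
Proof.
move=> /andP[x0 x1]; elim: n => [|n IH].
  by rewrite rbinS rbin0 addr0 divr1 mul1r oppr_le0.
rewrite rbinS mulr_le0_ge0// divr_ge0// -natr1.
by have : 0 <= n%:R :> R := ler0n _ _; lra.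
Qed.

Lemma rbin_1 (R : realType) n : rbin n 1 = 1 :> R.
Proof.
elim: n => [|n IH]; first by rewrite rbin0.
by rewrite rbinS IH mul1r nat1r divff// pnatr_eq0.
Qed.

Lemma rbin_0 (R : realType) n : rbin n 0 = (n == 0)%:R :> R.
Proof.
elim: n => [|n IH]; first by rewrite rbin0.
rewrite rbinS IH add0r; by case: n {IH} => [|n] /=; rewrite ?mul0r ?mulr0.
Qed.

(* Vandermonde: the coefficients of (1 - z)^(-x) (1 - z)^(-y). *)
Lemma rbinD (R : realType) n (x y : R) :
  rbin n (x + y) = \sum_(k < n.+1) rbin k x * rbin (n - k) y.
Proof.
elim: n => [|n IH]; first by rewrite big_ord1 !rbin0 mulr1.
apply: (@mulfI _ n.+1%:R); first by rewrite pnatr_eq0.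
rewrite mul_rbinS IH.
(* Splitting n + 1 as k + (n + 1 - k) is the Leibniz rule for z d/dz; after an index shift in the
   first sum, [mul_rbinS] applies to each half and the weights x + k and y + n - k add up to x + y +
   n. *)
have -> : n.+1%:R * (\sum_(k < n.+2) rbin k x * rbin (n.+1 - k) y) =
  \sum_(k < n.+2) (k%:R * rbin k x) * rbin (n.+1 - k) y +
  \sum_(k < n.+2) rbin k x * ((n.+1 - k)%:R * rbin (n.+1 - k) y).
  rewrite mulr_sumr -big_split; apply: eq_bigr => k _ /=.
  rewrite natrB; last by rewrite -ltnS.
  ring.
rewrite [X in _ = X + _]big_ord_recl/= !mul0r add0r.
rewrite [X in _ = _ + X]big_ord_recr/= subnn mul0r mulr0 addr0.
rewrite -big_split mulr_sumr; apply: eq_bigr => k _ /=.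
rewrite /bump/= add1n mul_rbinS subSS subSn; last by rewrite -ltnS.
rewrite mul_rbinS natrB; last by rewrite -ltnS.
ring.
Qed.

(** Multiplying a power series by (1 - z)^-1 takes partial sums of its coefficients. *)
Lemma rbin_1D (R : realType) n (x : R) : rbin n (1 + x) = \sum_(k < n.+1) rbin k x.
Proof. by rewrite addrC rbinD; apply: eq_bigr => k _; rewrite rbin_1 mulr1. Qed.

(* The derivative of (1 - r)^x \sum_(k <= n) rbin k x r^k telescopes to
   - (n + 1) rbin (n + 1) x r^n (1 - r)^(x - 1). *)
Lemma sum_rbin_le (R : realType) n (x r : R) : 0 <= x -> 0 < r < 1 ->
  \sum_(k < n.+1) rbin k x * r ^+ k <= (1 - r) `^ (- x).
Proof.
move=> x0 /andP[r0 r1].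
pose S z : R := \sum_(k < n.+1) rbin k x * z ^+ k.
(* The exponential is (1 - z)^x, in a form that is differentiated directly for z < 1. *)
pose h z := expR (x * ln (1 - z)) * S z.
pose S' z : R := \sum_(k < n.+1) rbin k x * (k%:R * z ^+ k.-1).
have dS (z : R) : is_derive z 1 S (S' z).
  have -> : S = \sum_(k < n.+1) (rbin k x \*: (@id R ^+ k)).
    by apply/funext => y; rewrite fct_sumE; apply: eq_bigr => k _; rewrite /= exprfctE.
  apply: is_derive_eq; rewrite /S'; apply: eq_bigr => k _.
  by rewrite /GRing.scale/= mulr1.
have dh (z : R) : z < 1 -> is_derive z 1 h
    (expR (x * ln (1 - z)) * (S' z - x / (1 - z) * S z)).
  move=> z1.
  have z1' : 0 < 1 - z by rewrite subr_gt0.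
  have dl : is_derive z 1 (fun z : R => expR (x * ln (1 - z)))
      (expR (x * ln (1 - z)) * (x * - (1 - z)^-1)).
    apply: (@is_derive1_comp _ expR (fun z : R => x * ln (1 - z))).
    have d2 : is_derive z 1 (@ln R \o (cst 1 - @id R)) ((1 - z)^-1 * (0 - 1)).
      by apply: is_derive1_comp; exact: is_derive1_ln.
    by have := is_deriveZ x d2; rewrite /GRing.scale/= sub0r mulrN1.
  have := is_deriveM dl (dS z); rewrite /GRing.scale/= => H.
  apply: (is_derive_eq H); ring.
have key (z : R) : z < 1 -> (1 - z) * S' z - x * S z = - (n.+1%:R * rbin n.+1 x * z ^+ n).
  move=> z1; rewrite /S' /S; clear; elim: n => [|n IH].
    by rewrite !big_ord1 mul_rbinS rbin0 !expr0 /=; ring.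
  rewrite big_ord_recr [X in _ - _ * X]big_ord_recr/= [in RHS]mul_rbinS -natr1.
  rewrite exprS.
  have -> : rbin n.+1 x * ((n%:R + 1) * z ^+ n) = n.+1%:R * rbin n.+1 x * z ^+ n.
    by rewrite -natr1; ring.
  rewrite [X in X - _]mulrDr [X in _ - X]mulrDr opprD addrACA IH.
  rewrite -natr1; ring.
have S0 : S 0 = 1.
  rewrite /S big_ord_recl/= rbin0 mul1r big1 ?addr0// => i _.
  by rewrite /bump/= expr0n/= mulr0.
have : h r <= h 0.
  apply: (@ler0_derive1_nincr _ h 0 r) => //.
  - by move=> z; rewrite in_itv/= => /andP[_ zr]; have [] := dh z (lt_trans zr r1).
  - move=> z; rewrite in_itv/= => /andP[z0 zr].
    have z1 := lt_trans zr r1.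
    rewrite derive1E (@derive_val _ _ _ _ _ _ _ (dh z z1)).
    rewrite mulr_ge0_le0 ?expR_ge0//.
    have z1' : 0 < 1 - z by rewrite subr_gt0.
    rewrite -(pmulr_rle0 _ z1') mulrBr mulrA [X in _ - X * _]mulrC divfK ?gt_eqF// key//.
    by rewrite oppr_le0 !mulr_ge0 ?exprn_ge0 ?rbin_ge0// ltW.
  - apply: derivable_within_continuous => z; rewrite in_itv/= => /andP[_ zr].
    by have [] := dh z (le_lt_trans zr r1).
  - exact: ltW.
rewrite /h subr0 ln1 mulr0 expR0 mul1r S0.
have r1' : 0 < 1 - r by rewrite subr_gt0.
rewrite /powR gt_eqF// mulNr expRN => H.
by rewrite -[leRHS]mul1r ler_pdivlMr ?expR_gt0// mulrC.
Qed.

(** A Cauchy estimate at radius r, applied to the partial sum of [rbin_1D]. Compared with estimating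
    (1 - z)^-(1 + x) directly, it saves a factor (1 - r)^-1, which would be of order n for r = 1 - K
    / n. *)
Lemma rbin_1D_le (R : realType) n (x r : R) : 0 <= x -> 0 < r < 1 ->
  rbin n (1 + x) <= (r ^+ n)^-1 * (1 - r) `^ (- x).
Proof.
move=> x0 /andP[r0 r1].
rewrite mulrC ler_pdivlMr ?exprn_gt0// (le_trans _ (sum_rbin_le n x0 _)) ?r0//.
rewrite rbin_1D mulr_suml; apply: ler_sum => k _.
rewrite ler_wpM2l ?rbin_ge0//.
by apply: ler_wiXn2l; [exact: ltW|exact: ltW|rewrite -ltnS].
Qed.

(** * The discrete relaxation equation *)

(* [grunwald a n l x] is the coefficient of z^n in
   (1 - z)^(-x) / (1 + l (1 - z)^(-a)), expanded in powers of l. *)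
Definition grunwald_term {R : realType} (a : R) (n : nat) (l x : R) (j : nat) : R :=
  (- l) ^+ j * rbin n (x + j%:R * a).

Definition grunwald {R : realType} (a : R) (n : nat) (l x : R) : R :=
  limn (fun J => \sum_(j < J) grunwald_term a n l x j).

Lemma geometric_majorant_cvg (R : realType) (c : nat -> R) (C q : R) :
  0 <= q < 1 -> (forall j, `|c j| <= C * q ^+ j) ->
  cvgn (fun J => \sum_(j < J) c j).
Proof.
move=> /andP[q0 q1] cC.
have -> : (fun J => \sum_(j < J) c j) = series c.
  by apply/funext => J; rewrite seriesEord.
apply: normed_cvg.
apply: (@series_le_cvg _ _ (geometric C q)) => //.
- by move=> j /=.
- by move=> j; exact: le_trans (cC j).
- by apply: is_cvg_geometric_series; rewrite ger0_norm.
Qed.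

(** The bound involves c only through C and q, so it is uniform over a family of series with a
    common majorant. *)
Lemma geometric_majorant_tail (R : realType) (c : nat -> R) (C q : R) J :
  0 <= q < 1 -> (forall j, `|c j| <= C * q ^+ j) ->
  `|limn (fun J => \sum_(j < J) c j) - \sum_(j < J) c j| <= C * q ^+ J / (1 - q).
Proof.
move=> q01 cC; have cvg_c := geometric_majorant_cvg q01 cC.
have /andP[q0 q1] := q01.
have C0 : 0 <= C by have := le_trans (normr_ge0 _) (cC 0%N); rewrite expr0 mulr1.
have cv : `|\sum_(j < K) c j - \sum_(j < J) c j| @[K --> \oo] -->
    `|limn (fun J => \sum_(j < J) c j) - \sum_(j < J) c j|.
  by apply: cvg_norm; apply: cvgB => //; exact: cvg_cst.
rewrite -(cvg_lim _ cv)//; apply: limr_le; first by apply: cvgP cv.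
exists J => //= K /= JK.
rewrite -!(big_mkord xpredT) (big_cat_nat (n := J))//= addrAC subrr add0r.
rewrite (le_trans (ler_norm_sum _ _ _))//.
rewrite (le_trans (ler_sum _ (fun j _ => cC j)))//.
rewrite -mulr_sumr -mulrA ler_wpM2l// -{1}[J]add0n big_addn.
under eq_bigr do rewrite exprD.
rewrite -mulr_suml mulrC ler_wpM2l ?exprn_ge0// big_mkord.
rewrite -[leRHS]mul1r ler_pdivlMr ?subr_gt0//.
by rewrite mulrC -opprB mulNr -subrX1 opprB lerBlDr lerDl exprn_ge0.
Qed.

(** [rbin_1D_le] at the exponent x + j a produces (1 - r)^-(j a), so the series in j is dominated by
    a geometric one. *)
Lemma grunwald_term_1D_le (R : realType) (a l r x : R) n j :
  0 <= a -> 0 <= l -> 0 < r < 1 -> 0 <= x ->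
  `|grunwald_term a n l (1 + x) j| <=
  (r ^+ n)^-1 * (1 - r) `^ (- x) * (l * (1 - r) `^ (- a)) ^+ j.
Proof.
move=> a0 l0 r01 x0; have /andP[_ r1] := r01.
have xja : 0 <= x + j%:R * a by rewrite addr_ge0// mulr_ge0.
have yja : 0 <= 1 + (x + j%:R * a) by rewrite addr_ge0.
rewrite /grunwald_term -addrA normrM normrX normrN !ger0_norm ?rbin_ge0//.
rewrite exprMn mulrCA ler_wpM2l ?exprn_ge0//.
rewrite (le_trans (rbin_1D_le n xja r01))// -mulrA.
rewrite opprD powRD; last by rewrite [1 - r == 0]subr_eq0 (gt_eqF r1) implybT.
by rewrite -[_ `^ _ ^+ _]powR_mulrn ?powR_ge0// -powRrM mulNr [a * _]mulrC !mulrA.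
Qed.

Lemma grunwald_term_le (R : realType) (a l r x : R) n j :
  0 <= a -> 0 <= l -> 0 < r < 1 -> 0 <= x ->
  `|grunwald_term a n l x j| <=
  (r ^+ n)^-1 * (1 - r) `^ (- x) * (l * (1 - r) `^ (- a)) ^+ j.
Proof.
move=> a0 l0 r01 x0; apply: le_trans (grunwald_term_1D_le n j a0 l0 r01 x0).
have xja : 0 <= x + j%:R * a by rewrite addr_ge0// mulr_ge0.
have yja : 0 <= 1 + (x + j%:R * a) by rewrite addr_ge0.
rewrite /grunwald_term -addrA !normrM ler_wpM2l// !ger0_norm ?rbin_ge0//.
by rewrite ler_rbin// lerDr.
Qed.

Lemma cvg_grunwald (R : realType) (a l r x : R) n :
  0 <= a -> 0 <= l -> 0 < r < 1 -> l * (1 - r) `^ (- a) < 1 -> 0 <= x ->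
  \sum_(j < J) grunwald_term a n l x j @[J --> \oo] --> grunwald a n l x.
Proof.
move=> a0 l0 r01 q1 x0.
apply: (@geometric_majorant_cvg _ _ _ (l * (1 - r) `^ (- a))).
  by rewrite q1 mulr_ge0// powR_ge0.
by move=> j; exact: grunwald_term_le.
Qed.

(** Coefficient form of multiplying the generating function by its denominator 1 + l (1 - z)^-a: the
    factor (1 - z)^-a raises the exponent x by a. *)
Lemma grunwald_rec (R : realType) (a l r x : R) n :
  0 <= a -> 0 <= l -> 0 < r < 1 -> l * (1 - r) `^ (- a) < 1 -> 0 <= x ->
  grunwald a n l x + l * grunwald a n l (x + a) = rbin n x.
Proof.
move=> a0 l0 r01 q1 x0.
have xa0 : 0 <= x + a by rewrite addr_ge0.
have c1 := cvg_grunwald (n := n) a0 l0 r01 q1 x0.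
have c2 := cvg_grunwald (n := n) a0 l0 r01 q1 xa0.
(* The first sum keeps one more term: its term j + 1 cancels l times term j of the second sum, and
   only j = 0 survives. *)
rewrite -cvg_shiftS in c1.
have cu : (fun J => \sum_(j < J.+1) grunwald_term a n l x j +
    l * \sum_(j < J) grunwald_term a n l (x + a) j) @ \oo -->
    grunwald a n l x + l * grunwald a n l (x + a).
  by apply: cvgD c1 _; apply: cvgM c2; exact: cvg_cst.
apply: (cvg_unique (@Rhausdorff R) cu).
apply: cvg_near_cst; apply: nearW => J.
rewrite big_ord_recl -addrA mulr_sumr -big_split/= big1 ?addr0.
  by rewrite /grunwald_term expr0 mul1r mul0r addr0.
move=> i _; rewrite /grunwald_term /bump/= add1n exprS -natr1.
rewrite (_ : x + (i%:R + 1) * a = x + a + i%:R * a); last by ring.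
by ring.
Qed.

(** Vandermonde's identity under the sum over j. The exponent y may be negative; it is taken to be -
    a in [grunwald_ge0]. *)
Lemma grunwaldD (R : realType) (a l r x y : R) n :
  0 <= a -> 0 <= l -> 0 < r < 1 -> l * (1 - r) `^ (- a) < 1 ->
  0 <= x -> 0 <= y + x ->
  grunwald a n l (y + x) = \sum_(k < n.+1) rbin k y * grunwald a (n - k) l x.
Proof.
move=> a0 l0 r01 q1 x0 yx0.
have c1 := cvg_grunwald (n := n) a0 l0 r01 q1 yx0.
apply: (cvg_unique (@Rhausdorff R) c1).
have : (fun J => \sum_(k < n.+1) (rbin k y *
    \sum_(j < J) grunwald_term a (n - k) l x j)) @ \oo -->
    \sum_(k < n.+1) rbin k y * grunwald a (n - k) l x.
  apply: cvg_big => [|k _]; [exact: add_continuous|apply: cvgM]; first exact: cvg_cst.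
  exact: (cvg_grunwald a0 l0 r01).
apply: cvg_trans; apply: near_eq_cvg; near=> J.
under eq_bigr do rewrite mulr_sumr.
rewrite exchange_big/=; apply: eq_bigr => j _.
rewrite /grunwald_term -addrA rbinD mulr_sumr; apply: eq_bigr => k _.
by rewrite mulrCA.
Unshelve. all: by end_near. Qed.

(* Multiplying by (1 - z)^a + l, all of whose coefficients after the first
   are nonpositive, makes the coefficients a positive recursion. *)
Lemma grunwald_ge0 (R : realType) (a l r x : R) n :
  0 <= a <= 1 -> 0 <= l -> 0 < r < 1 -> l * (1 - r) `^ (- a) < 1 ->
  a <= x -> 0 <= grunwald a n l x.
Proof.
move=> a01 l0 r01 q1 ax; have /andP[a0 a1] := a01.
have xa0 : 0 <= - a + x by rewrite addrC subr_ge0.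
have x0 := le_trans a0 ax.
have [m] := ubnP n; elim: m n => // m IH n; rewrite ltnS => nm.
have := grunwald_rec n a0 l0 r01 q1 xa0.
(* The term k = 0 of the convolution is [grunwald a n l x] itself. The others have index below n
   and, once moved to the other side, the nonnegative weights - [rbin k (- a)]. *)
rewrite (grunwaldD n a0 l0 r01 q1 x0 xa0) big_ord_recl/= rbin0 mul1r subn0.
rewrite [- a + x]addrC subrK => E.
suff : 0 <= (1 + l) * grunwald a n l x by rewrite pmulr_rge0// ltr_pwDl.
have -> : (1 + l) * grunwald a n l x = rbin n (x - a) +
    \sum_(i < n) (- rbin (bump 0 i) (- a)) * grunwald a (n - bump 0 i) l x.
  rewrite -E mulrDl mul1r.
  under [X in _ = _ + X]eq_bigr do rewrite mulNr.
  by rewrite sumrN; ring.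
rewrite addr_ge0// ?rbin_ge0 ?subr_ge0// sumr_ge0// => i _.
rewrite /bump/= add1n mulr_ge0 ?oppr_ge0 ?rbinN_le0// IH//.
by rewrite (leq_trans _ nm)// ltn_subrL/= (leq_ltn_trans _ (ltn_ord i)).
Qed.

(** The increment at n + 1 is the coefficient for exponent 0, and by [grunwald_rec] this equals - l
    times the coefficient for exponent a, whose sign is known. *)
Lemma grunwald1_nonincreasing (R : realType) (a l r : R) :
  0 <= a <= 1 -> 0 <= l -> 0 < r < 1 -> l * (1 - r) `^ (- a) < 1 ->
  {homo (fun n => grunwald a n l 1) : m n / (m <= n)%N >-> n <= m}.
Proof.
move=> a01 l0 r01 q1; have /andP[a0 a1] := a01.
apply/nonincreasing_seqP => n.
have E k : grunwald a k l 1 = \sum_(m < k.+1) grunwald a m l 0.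
  have := grunwaldD k a0 l0 r01 q1 (lexx 0) (_ : 0 <= 1 + 0).
  rewrite addr0 => ->//; rewrite (reindex_inj rev_ord_inj)/=.
  by apply: eq_bigr => m _; rewrite rbin_1 mul1r subSS subKn// -ltnS.
rewrite !E [leLHS]big_ord_recr/= gerDl.
have := grunwald_rec n.+1 a0 l0 r01 q1 (lexx 0).
rewrite rbin_0 add0r => /eqP; rewrite addr_eq0 => /eqP ->.
by rewrite oppr_le0 mulr_ge0// (grunwald_ge0 _ a01 l0 r01).
Qed.

(** [grunwald_rec] at x = 1 says that u_n plus l times a convolution of u with [rbin k a] is 1.
    Monotonicity replaces each u_(n-k) by u_n from below, and the remaining weights sum to
    [rbin n (1 + a)]. *)
Lemma grunwald1_le (R : realType) (a l r : R) n :
  0 <= a <= 1 -> 0 <= l -> 0 < r < 1 -> l * (1 - r) `^ (- a) < 1 ->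
  grunwald a n l 1 * (1 + l * rbin n (1 + a)) <= 1.
Proof.
move=> a01 l0 r01 q1; have /andP[a0 a1] := a01.
have := grunwald_rec n a0 l0 r01 q1 (@ler01 R).
rewrite rbin_1 => E; rewrite -[leRHS]E mulrDr mulr1 lerD2l mulrCA ler_wpM2l//.
rewrite [1 + a in leRHS]addrC (grunwaldD n a0 l0 r01)// ?addr_ge0//.
rewrite rbin_1D mulr_sumr; apply: ler_sum => k _.
rewrite mulrC ler_wpM2l ?rbin_ge0//.
by rewrite (grunwald1_nonincreasing a01 l0 r01)// leq_subr.
Qed.

(** * The Gamma function and Gauss's limit *)

Lemma integrable_mull d (T : measurableType d) (R : realType)
    (m : {measure set T -> \bar R}) (D : set T) (k : R) (f : T -> R) :
  measurable D -> m.-integrable D (EFin \o f) ->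
  m.-integrable D (EFin \o (fun x => k * f x)).
Proof.
move=> mD i; apply: (eq_integrable mD _ _ _ (integrableZl mD k i)) => x _.
by rewrite /= EFinM.
Qed.

Lemma integrable_add d (T : measurableType d) (R : realType)
    (m : {measure set T -> \bar R}) (D : set T) (f g : T -> R) :
  measurable D -> m.-integrable D (EFin \o f) -> m.-integrable D (EFin \o g) ->
  m.-integrable D (EFin \o (fun x => f x + g x)).
Proof.
move=> mD i j; apply: (eq_integrable mD _ _ _ (integrableD mD i j)) => x _.
by rewrite /= EFinD.
Qed.

Lemma integrable_sub d (T : measurableType d) (R : realType)
    (m : {measure set T -> \bar R}) (D : set T) (f g : T -> R) :
  measurable D -> m.-integrable D (EFin \o f) -> m.-integrable D (EFin \o g) ->
  m.-integrable D (EFin \o (fun x => f x - g x)).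
Proof.
move=> mD i j; apply: (eq_integrable mD _ _ _ (integrableB mD i j)) => x _.
by rewrite /= EFinB.
Qed.

(** The inequality u <= expR u at u = y / (2 x), raised to the power x. *)
Lemma powR_le_expR (R : realType) (x y : R) : 0 <= x -> 0 <= y ->
  y `^ x <= (2 * x) `^ x * expR (2^-1 * y).
Proof.
rewrite le_eqVlt => /predU1P[<- y0|x0 y0].
  by rewrite !powRr0 mul1r -expR0 ler_expR mulr_ge0// invr_ge0.
have x20 : 0 < 2 * x by rewrite mulr_gt0.
have yle : y <= 2 * x * expR (y / (2 * x)).
  rewrite mulrC -ler_pdivrMr// (le_trans _ (expR_ge1Dx _))// lerDr//.
rewrite (le_trans (ge0_ler_powR (ltW x0) _ _ yle)) ?nnegrE//.
  by rewrite mulr_ge0 ?expR_ge0 ?(ltW x20).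
rewrite powRM ?expR_ge0 ?(ltW x20)// ler_wpM2l ?powR_ge0// -expRM.
by rewrite ler_expR le_eqVlt; apply/orP; left; apply/eqP; field; rewrite gt_eqF.
Qed.

Lemma powR_expRN_le (R : realType) (x y : R) : 0 <= x -> 0 <= y ->
  y `^ x * expR (- y) <= (2 * x) `^ x * expR (- (2^-1 * y)).
Proof.
move=> x0 y0; rewrite -ler_pdivlMr ?expR_gt0// -expRN opprK -mulrA -expRD.
by rewrite (_ : - (2^-1 * y) + y = 2^-1 * y) ?powR_le_expR//; field.
Qed.

Lemma is_derive_expRN_scale (R : realType) (c x : R) :
  is_derive x 1 (fun y => expR (- (c * y))) (- c * expR (- (c * x))).
Proof.
have d : is_derive x 1 (fun y : R => - (c * y)) (- c).
  have := is_deriveZ (- c) (is_derive_id x (1 : R)).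
  rewrite /GRing.scale/= mulr1; congr is_derive.
  by apply/funext => y; exact: mulNr.
have := @is_derive1_comp _ expR (fun y : R => - (c * y)) x _ _ (is_derive_expR _) d.
by rewrite mulrC.
Qed.

Lemma cvg_expRN_scale (R : realType) (c : R) : 0 < c ->
  expR (- (c * x)) @[x --> +oo] --> (0 : R).
Proof.
move=> c0.
apply: (@cvg_comp _ _ _ (fun x => c * x) (fun z => expR (- z)) _ (pinfty_nbhs R)).
  exact: gt0_cvgMry.
exact: cvgr_expR.
Qed.

Lemma integral_expRN_scale (R : realType) (c : R) : 0 < c ->
  (\int[@lebesgue_measure R]_(x in `[0%R, +oo[) (expR (- (c * x)))%:E = (c^-1)%:E)%E.
Proof.
move=> c0.
have ce : continuous (fun x : R => expR (- (c * x))).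
  move=> x; apply: differentiable_continuous; apply/derivable1_diffP.
  exact: (@ex_derive _ _ _ _ _ _ _ (is_derive_expRN_scale c x)).
have dF (x : R) : is_derive x 1 (fun y => - c^-1 * expR (- (c * y))) (expR (- (c * x))).
  have := is_deriveZ (- c^-1) (is_derive_expRN_scale c x).
  by rewrite /GRing.scale/= mulrA mulrNN mulVf ?gt_eqF// mul1r.
rewrite (@ge0_continuous_FTC2y _ _ (fun x => - c^-1 * expR (- (c * x))) _ 0)//.
- by rewrite mulr0 oppr0 expR0 mulr1 EFinN oppeK add0e.
- exact: continuous_subspaceT.
- rewrite -(mulr0 (- c^-1)); apply: cvgM; first exact: cvg_cst.
  exact: cvg_expRN_scale.
- by apply: cvg_at_right_filter; apply: cvgM; [exact: cvg_cst|exact: ce].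
- by move=> x _; rewrite derive1E; apply: derive_val; exact: dF.
Qed.

Lemma integrable_expRN_scale (R : realType) (c : R) : 0 < c ->
  (@lebesgue_measure R).-integrable `]0, +oo[ (EFin \o (fun x => expR (- (c * x)))).
Proof.
move=> c0.
have m : measurable_fun (`]0, +oo[%classic : set R) (fun x : R => expR (- (c * x))).
  apply: measurable_funTS; apply: measurableT_comp => //.
  exact: measurableT_comp.
apply/integrableP; split; first exact/measurable_EFinP.
under eq_integral => x _ do rewrite /= ger0_norm ?expR_ge0//.
rewrite integral_itv_obnd_cbnd ?integral_expRN_scale ?ltry//.
exact/measurable_EFinP.
Qed.

Lemma integrable_Gamma (R : realType) (x : R) : 0 <= x ->
  (@lebesgue_measure R).-integrable `]0, +oo[
    (EFin \o (fun y => y `^ x * expR (- y))).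
Proof.
move=> x0.
have m : measurable_fun (`]0, +oo[%classic : set R) (fun y : R => y `^ x * expR (- y)).
  apply: measurable_funTS; apply: measurable_funM => //.
  exact: measurableT_comp.
have ie : (@lebesgue_measure R).-integrable `]0, +oo[
    (fun y => ((2 * x) `^ x)%:E * (EFin \o (fun y => expR (- (2^-1 * y)))) y)%E.
  by apply: integrableZl => //; exact: integrable_expRN_scale.
apply: le_integrable ie => //; first exact/measurable_EFinP.
move=> y /=; rewrite in_itv/= andbT => y0; rewrite lee_fin.
rewrite !ger0_norm ?mulr_ge0 ?powR_ge0 ?expR_ge0//.
by rewrite powR_expRN_le// ltW.
Qed.

Lemma GammaE (R : realType) (x : R) : Gamma (1 + x) =
  \int[@lebesgue_measure R]_(y in `]0, +oo[) (y `^ x * expR (- y)).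
Proof. by rewrite /Gamma; apply: eq_Rintegral => y _; rewrite [1 + x]addrC addrK. Qed.

(* The integrand of the integration by parts is made nonnegative by adding a
   multiple of expR (- y / 2), as the improper fundamental theorem requires. *)
Lemma GammaS (R : realType) (x : R) : 0 <= x ->
  Gamma (1 + (x + 1)) = (x + 1) * Gamma (1 + x).
Proof.
move=> x0; rewrite !GammaE.
(* By [powR_expRN_le], this C makes [C * e y] dominate the negative term of [f]. The added mass is 2
   C, which is also - [F 0], so it cancels in the end. *)
pose C := (x + 1) * (2 * x) `^ x.
have x10 : 0 < x + 1 by rewrite ltr_wpDl.
pose e (y : R) := expR (- (2^-1 * y)).
pose f (y : R) := y `^ (x + 1) * expR (- y) - (x + 1) * (y `^ x * expR (- y)) + C * e y.
pose F (y : R) := - (y `^ (x + 1) * expR (- y)) - 2 * C * e y.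
have ie : (@lebesgue_measure R).-integrable `]0%R, +oo[ (EFin \o e).
  exact: integrable_expRN_scale.
have x1ge := ltW x10.
have i1 := integrable_Gamma x1ge.
have i0 := integrable_Gamma x0.
have i0' : (@lebesgue_measure R).-integrable `]0%R, +oo[
    (EFin \o (fun y => (x + 1) * (y `^ x * expR (- y)))).
  by apply: integrable_mull.
have ie' : (@lebesgue_measure R).-integrable `]0%R, +oo[ (EFin \o (fun y => C * e y)).
  by apply: integrable_mull.
have i10 : (@lebesgue_measure R).-integrable `]0%R, +oo[
    (EFin \o (fun y => y `^ (x + 1) * expR (- y) - (x + 1) * (y `^ x * expR (- y)))).
  by apply: integrable_sub.
have ifm : (@lebesgue_measure R).-integrable `]0%R, +oo[ (EFin \o f).
  by apply: integrable_add.
have Ie : \int[@lebesgue_measure R]_(y in `]0, +oo[) e y = 2.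
  rewrite Rintegral_itv_obnd_cbnd// /Rintegral.
  rewrite [X in fine X](integral_expRN_scale (_ : 0 < 2^-1))//.
  by rewrite /= invrK.
have If : \int[@lebesgue_measure R]_(y in `]0, +oo[) f y =
    \int[@lebesgue_measure R]_(y in `]0, +oo[) (y `^ (x + 1) * expR (- y)) -
    (x + 1) * \int[@lebesgue_measure R]_(y in `]0, +oo[) (y `^ x * expR (- y)) + 2 * C.
  by rewrite RintegralD// RintegralB// RintegralZl// RintegralZl// Ie [C * 2]mulrC.
suff : \int[@lebesgue_measure R]_(y in `]0, +oo[) f y = 2 * C by rewrite If; lra.
have dF (y : R) : 0 < y -> is_derive y 1 F (f y).
  move=> y0.
  have d1 : is_derive y 1 (fun y => expR (- y)) (- expR (- y)).
    have := is_derive_expRN_scale 1 y; rewrite mul1r mulN1r.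
    by under eq_fun do rewrite mul1r.
  have d2 := is_deriveM (is_derive1_powR (x + 1) y0) d1.
  have d3 := is_deriveB (is_deriveN d2)
    (is_deriveZ (2 * C) (is_derive_expRN_scale 2^-1 y)).
  apply: (is_derive_eq d3); rewrite /GRing.scale/= addrK /f /e.
  by field.
have cp (z : R) : 0 <= z ->
    {within `[0%R, +oo[, continuous (fun y : R => y `^ z * expR (- y))}.
  move=> z0; apply/continuous_within_itvcyP; split.
    move=> y; rewrite in_itv/= andbT => y0.
    apply: cvgM; last first.
      by apply: continuous_comp; [exact: opp_continuous|exact: continuous_expR].
    suff : {for y, continuous (@powR R ^~ z)} by [].
    apply: differentiable_continuous; apply/derivable1_diffP.
    by apply: derivable_powR; rewrite in_itv/= y0.
  apply: cvgM; last first.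
    apply: cvg_at_right_filter.
    by apply: continuous_comp; [exact: opp_continuous|exact: continuous_expR].
  (* The value of [powR] at 0 is 1 for z = 0 and 0 for z > 0, so right continuity there needs two
     arguments. *)
  have [->|zN0] := eqVneq z 0.
    by under eq_fun do rewrite powRr0; rewrite powRr0; exact: cvg_cst.
  by rewrite powR0//; apply: powR_cvg0; rewrite lt_neqAle eq_sym zN0.
have ce : continuous e.
  move=> y; apply: differentiable_continuous; apply/derivable1_diffP.
  exact: (@ex_derive _ _ _ _ _ _ _ (is_derive_expRN_scale 2^-1 y)).
rewrite Rintegral_itv_obnd_cbnd//.
rewrite (@Rintegral_ge0_continuous_FTC2y _ f F 0 0).
- by rewrite /F powR0 ?gt_eqF// mul0r oppr0 /e mulr0 oppr0 expR0 mulr1 !sub0r opprK.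
- move=> y y0; rewrite /f /C /e.
  have := ler_wpM2l x1ge (powR_expRN_le x0 y0).
  have : 0 <= y `^ (x + 1) * expR (- y) by rewrite mulr_ge0 ?powR_ge0 ?expR_ge0.
  by lra.
- move=> y; apply: cvgD; first apply: cvgB.
  + exact: cp.
  + by apply: cvgM; [exact: cvg_cst|exact: cp].
  + by apply: cvgM; [exact: cvg_cst|exact: continuous_subspaceT].
- rewrite -[X in _ --> X](subr0 0) -{1}oppr0; apply: cvgB.
    apply: cvgN; apply: (@squeeze_cvgr _ _ _ _ (cst 0)
      (fun y => (2 * (x + 1)) `^ (x + 1) * e y)).
    + near=> y; rewrite mulr_ge0 ?powR_ge0 ?expR_ge0//= powR_expRN_le//.
    + exact: cvg_cst.
    + rewrite -(mulr0 ((2 * (x + 1)) `^ (x + 1))); apply: cvgM; first exact: cvg_cst.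
      exact: cvg_expRN_scale.
  rewrite -(mulr0 (2 * C)); apply: cvgM; first exact: cvg_cst.
  exact: cvg_expRN_scale.
- by move=> y y0; have [] := dF y y0.
- apply: cvgB; first apply: cvgN.
    by have /continuous_within_itvcyP[] := cp _ x1ge.
  by apply: cvg_at_right_filter; apply: cvgM; [exact: cvg_cst|exact: ce].
- move=> y; rewrite in_itv/= andbT => y0.
  by rewrite derive1E; apply: derive_val; exact: dF.
Unshelve. all: by end_near. Qed.

Lemma Gamma1 (R : realType) : Gamma (1 + 0) = 1 :> R.
Proof.
rewrite GammaE.
transitivity (\int[@lebesgue_measure R]_(y in `]0, +oo[) expR (- (1 * y))).
  by apply: eq_Rintegral => y _; rewrite powRr0 !mul1r.
rewrite Rintegral_itv_obnd_cbnd; last exact: integrable_expRN_scale.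
by rewrite /Rintegral integral_expRN_scale// invr1.
Qed.

Lemma Gamma_ge0 (R : realType) (x : R) : 0 <= Gamma x.
Proof.
by apply: Rintegral_ge0 => y _; rewrite mulr_ge0 ?powR_ge0 ?expR_ge0.
Qed.

(** Young's inequality for the product of u^t and 1, with exponents 1 / t and 1 / (1 - t); the
    right-hand side is the tangent line at u = 1. *)
Lemma powR_le_affine (R : realType) (u t : R) : 0 <= u -> 0 <= t <= 1 ->
  u `^ t <= 1 - t + t * u.
Proof.
move=> u0 /andP[]; rewrite le_eqVlt => /predU1P[<- _|t0].
  by rewrite powRr0 subr0 mul0r addr0.
rewrite le_eqVlt => /predU1P[->|t1].
  by rewrite powRr1// subrr add0r mul1r.
have t1' : 0 < 1 - t by rewrite subr_gt0.
have := @conjugate_powR _ (u `^ t) 1 t^-1 (1 - t)^-1.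
rewrite !invrK -powRrM divff ?gt_eqF// powRr1// powR1 !mulr1 mul1r.
rewrite !invr_gt0 ler01 powR_ge0 t0 t1' addrC subrK.
by move=> /(_ erefl erefl erefl erefl erefl); rewrite [u * t]mulrC addrC.
Qed.

(* With N = x + 1, integrate y^(x + t) <= N^t y^x (1 - t + t y / N). *)
Lemma GammaD_le (R : realType) (x t : R) : 0 <= x -> 0 <= t <= 1 ->
  Gamma (1 + (x + t)) <= (x + 1) `^ t * Gamma (1 + x).
Proof.
move=> x0 t01; have /andP[t0 t1] := t01.
have N0 : 0 < x + 1 by rewrite ltr_wpDl.
have i0 := integrable_Gamma x0.
have i1 := integrable_Gamma (ltW N0).
(* By the functional equation the two parts of the affine bound integrate to the fractions 1 - t and
   t of the right-hand side. *)
have -> : (x + 1) `^ t * Gamma (1 + x) =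
    (x + 1) `^ t * (1 - t) * Gamma (1 + x) +
    (x + 1) `^ t * (t / (x + 1)) * Gamma (1 + (x + 1)).
  by rewrite GammaS//; field; rewrite gt_eqF.
have j0 : (@lebesgue_measure R).-integrable `]0, +oo[ (EFin \o
    (fun y => (x + 1) `^ t * (1 - t) * (y `^ x * expR (- y)))).
  by apply: integrable_mull.
have j1 : (@lebesgue_measure R).-integrable `]0, +oo[ (EFin \o
    (fun y => (x + 1) `^ t * (t / (x + 1)) * (y `^ (x + 1) * expR (- y)))).
  by apply: integrable_mull.
rewrite !GammaE -!RintegralZl// -RintegralD//.
apply: le_Rintegral => //.
- by apply: integrable_Gamma; rewrite addr_ge0.
- by apply: integrable_add.
- move=> y /=; rewrite in_itv/= andbT => y0.
  have yN0 : (y != 0) by rewrite gt_eqF.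
  rewrite !powRD ?yN0 ?implybT// powRr1 ?(ltW y0)//.
  have -> : y `^ t = (x + 1) `^ t * (y / (x + 1)) `^ t.
    rewrite -powRM ?divr_ge0 ?(ltW y0) ?(ltW N0)//.
    by rewrite mulrC divfK// gt_eqF.
  rewrite !mulrA -mulrDl ler_wpM2r ?expR_ge0//.
  have -> : (x + 1) `^ t * (1 - t) * y `^ x + (x + 1) `^ t * t / (x + 1) * y `^ x * y =
    y `^ x * (x + 1) `^ t * (1 - t + t * (y / (x + 1))) by ring.
  rewrite ler_wpM2l ?mulr_ge0 ?powR_ge0// powR_le_affine//.
  by rewrite divr_ge0 ?(ltW y0) ?(ltW N0).
Qed.

Lemma Gamma_fact (R : realType) n : Gamma (1 + n%:R) = n`!%:R :> R.
Proof.
elim: n => [|n IH]; first by rewrite Gamma1.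
by rewrite -[n.+1%:R]natr1 GammaS// IH factS natrM natr1.
Qed.

(** The product of n! and [rbin n (1 + x)] is the rising factorial (1 + x) ... (n + x), so this is
    the functional equation used n times. *)
Lemma Gamma_rbin (R : realType) (x : R) n : 0 <= x ->
  n`!%:R * rbin n (1 + x) * Gamma (1 + x) = Gamma (1 + (n%:R + x)).
Proof.
move=> x0; elim: n => [|n IH]; first by rewrite rbin0 !mul1r add0r.
rewrite factS natrM -[n.+1%:R in RHS]natr1 addrAC GammaS ?addr_ge0// -IH.
have E := mul_rbinS n (1 + x).
rewrite (_ : _ * _ = n`!%:R * (n.+1%:R * rbin n.+1 (1 + x)) * Gamma (1 + x)).
  by rewrite E; ring.
by ring.
Qed.

Lemma nat_fraction_split (R : realType) (x : R) : 0 <= x ->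
  exists n t, 0 <= t <= 1 /\ x = t + n%:R.
Proof.
move=> x0; exists (Num.trunc x), (x - (Num.trunc x)%:R).
have /andP[h1 h2] := truncn_itv x0.
by rewrite subrK subr_ge0 h1 lerBlDr nat1r ltW.
Qed.

(** [GammaD_le], used to go up from x to an integer, bounds a factorial by a multiple of Gamma (1 +
    x), which therefore cannot vanish. *)
Lemma Gamma_gt0 (R : realType) (x : R) : 0 <= x -> 0 < Gamma (1 + x).
Proof.
move=> x0; have [n [t [/andP[t0 t1] xE]]] := nat_fraction_split x0.
have h : 0 <= 1 - t <= 1 by rewrite subr_ge0 t1 lerBlDr lerDl t0.
have := GammaD_le x0 h.
have -> : x + (1 - t) = n.+1%:R by rewrite xE -natr1; ring.
rewrite Gamma_fact => H.
rewrite lt_neqAle Gamma_ge0 andbT; apply/eqP => E.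
by move: H; rewrite -E mulr0 lern0 -leqn0 leqNgt fact_gt0.
Qed.

Lemma cvg_ratio_nat (R : realType) (c d : R) :
  (n%:R + c) / (n%:R + d) @[n --> \oo] --> (1 : R).
Proof.
have -> : (1 : R) = 1 + (c - d) * 0 by rewrite mulr0 addr0.
have h : (n%:R + d)^-1 @[n --> \oo] --> (0 : R).
  have pos : \forall n \near \oo, 0 < n%:R + d.
    by near=> n; rewrite -ltrBlDr sub0r; near: n; exact: nbhs_infty_gtr.
  apply/(gtr0_cvgV0 pos)/cvgryPgt => A; near=> n.
  by rewrite -ltrBlDr; near: n; exact: nbhs_infty_gtr.
have H : 1 + (c - d) * (n%:R + d)^-1 @[n --> \oo] --> 1 + (c - d) * 0.
  by apply: cvgD; [exact: cvg_cst|apply: cvgM; [exact: cvg_cst|exact: h]].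
apply: cvg_trans H.
apply: near_eq_cvg; near=> n => /=.
have : n%:R + d != 0.
  rewrite gt_eqF// -ltrBlDr sub0r.
  by near: n; exact: nbhs_infty_gtr.
by move=> ?; field.
Unshelve. all: by end_near. Qed.

(** Adding 1 to x multiplies the ratio by (n + x + 1) / n, which tends to 1, so x can be reduced to
    t in [0, 1]. *)
Lemma Gamma_ratio_cvg (R : realType) (x : R) : 0 <= x ->
  Gamma (1 + (n%:R + x)) / (n`!%:R * n%:R `^ x) @[n --> \oo] --> (1 : R).
Proof.
move=> x0; have [m [t [/andP[t0 t1] ->]]] := nat_fraction_split x0.
elim: m {x x0} => [|m IH]; last first.
  have t0' : 0 <= t + m%:R by rewrite addr_ge0.
  have H : (n%:R + (t + m.+1%:R)) / (n%:R + 0) *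
      (Gamma (1 + (n%:R + (t + m%:R))) / (n`!%:R * n%:R `^ (t + m%:R)))
      @[n --> \oo] --> (1 : R).
    by rewrite -[X in _ --> X]mulr1; apply: cvgM IH; exact: cvg_ratio_nat.
  apply: cvg_trans H; apply: near_eq_cvg; near=> n => /=.
  have n0 : n%:R != 0 :> R by rewrite pnatr_eq0 -lt0n; near: n; exact: nbhs_infty_gt.
  have -> : n%:R + (t + m.+1%:R) = n%:R + (t + m%:R) + 1 by rewrite -natr1; ring.
  rewrite GammaS ?addr_ge0//.
  have -> : n%:R `^ (t + m.+1%:R) = n%:R `^ (t + m%:R) * n%:R.
    by rewrite -natr1 addrA powRD ?n0 ?implybT// powRr1.
  have P0 : n%:R `^ (t + m%:R) != 0.
    by rewrite powR_eq0 negb_and n0.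
  have F0 : n`!%:R != 0 :> R by rewrite pnatr_eq0 -lt0n fact_gt0.
  by field; rewrite F0 P0 n0.
rewrite addr0.
(* The lower bound is [GammaD_le] from n + t up to n + 1, the upper bound is [GammaD_le] from n up
   to n + t. *)
apply: (@squeeze_cvgr _ _ _ _ (fun n => (n%:R + 1) / (n%:R + 2))
  (fun n => (n%:R + 1) / (n%:R + 0))).
- near=> n.
  have n0 : 0 < n%:R :> R by rewrite ltr0n; near: n; exact: nbhs_infty_gt.
  have F0 : 0 < n`!%:R :> R by rewrite ltr0n fact_gt0.
  have n10 : 0 < n%:R + 1 :> R by rewrite addr_gt0.
  have Pt : 0 < n%:R `^ t by rewrite powR_gt0.
  apply/andP; split.
    have h : 0 <= 1 - t <= 1 by rewrite subr_ge0 t1 lerBlDr lerDl t0.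
    have nt0 : 0 <= n%:R + t by rewrite addr_ge0.
    have := GammaD_le nt0 h.
    have -> : n%:R + t + (1 - t) = n.+1%:R by rewrite -natr1; ring.
    rewrite Gamma_fact factS natrM -natr1 => H.
    have H2 : (n%:R + t + 1) `^ (1 - t) * n%:R `^ t <= n%:R + 2.
      have n20 : 0 < n%:R + 2 :> R by rewrite addr_gt0.
      rewrite -[leRHS]powRr1 ?(ltW n20)// -[X in _ <= _ `^ X](subrK t).
      rewrite [leRHS]powRD ?(gt_eqF n20) ?implybT// ler_pM ?powR_ge0//.
        apply: ge0_ler_powR; rewrite ?nnegrE ?subr_ge0 ?addr_ge0 ?(ltW n20)//.
        by rewrite -addrA lerD2l; lra.
      apply: ge0_ler_powR; rewrite ?nnegrE ?(ltW n20)//.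
      by rewrite lerDl.
    rewrite ler_pdivlMr ?mulr_gt0// mulrAC ler_pdivrMr ?addr_gt0//.
    rewrite -(ler_pM2r Pt) in H.
    rewrite mulrA (le_trans H)// mulrAC mulrC ler_wpM2l//.
    exact: Gamma_ge0.
  rewrite addr0 ler_pdivrMr ?mulr_gt0//.
  have t01 : 0 <= t <= 1 by rewrite t0.
  have := GammaD_le (ltW n0) t01; rewrite Gamma_fact => /le_trans; apply.
  have n1n : n%:R + 1 = (n%:R + 1 : R) / n%:R * n%:R by rewrite divfK// gt_eqF.
  rewrite {1}n1n powRM ?divr_ge0 ?(ltW n10) ?(ltW n0)//.
  have h1 : 1 <= (n%:R + 1) / n%:R :> R by rewrite ler_pdivlMr// mul1r lerDl.
  rewrite -mulrA [n%:R `^ t * _]mulrC ler_wpM2r ?mulr_ge0 ?powR_ge0//.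
  exact: ler1_powR.
- exact: cvg_ratio_nat.
- exact: cvg_ratio_nat.
Unshelve. all: by end_near. Qed.

Lemma cvg_rbin (R : realType) (x : R) : 0 <= x ->
  rbin n (1 + x) / n%:R `^ x @[n --> \oo] --> (Gamma (1 + x))^-1.
Proof.
move=> x0; have G0 := Gamma_gt0 x0.
have H : Gamma (1 + (n%:R + x)) / (n`!%:R * n%:R `^ x) / Gamma (1 + x)
    @[n --> \oo] --> (Gamma (1 + x))^-1.
  rewrite -[X in _ --> X]mul1r.
  by apply: cvgM; [exact: Gamma_ratio_cvg|exact: cvg_cst].
apply: cvg_trans H; apply: near_eq_cvg; near=> n => /=.
have n0 : n%:R != 0 :> R by rewrite pnatr_eq0 -lt0n; near: n; exact: nbhs_infty_gt.
have P0 : n%:R `^ x != 0 by rewrite powR_eq0 negb_and n0.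
have F0 : n`!%:R != 0 :> R by rewrite pnatr_eq0 -lt0n fact_gt0.
rewrite -Gamma_rbin//; field.
by rewrite P0 F0 gt_eqF.
Unshelve. all: by end_near. Qed.

(** * Bounds on the Mittag-Leffler function *)

(** Dominated convergence for series: cut both series at a J where the common tail bound is at most
    e / 3, then pass to the limit in the finite sum. The filter is general, to serve both n -> oo
    and continuity at a point. *)
Lemma tannery_geometric (T : Type) (F : set_system T) {FF : ProperFilter F}
    (R : realType) (c : T -> nat -> R) (d : nat -> R) (C q : R) :
  0 <= q < 1 -> (\forall t \near F, forall j, `|c t j| <= C * q ^+ j) ->
  (forall j, c t j @[t --> F] --> d j) ->
  limn (fun J => \sum_(j < J) c t j) @[t --> F] --> limn (fun J => \sum_(j < J) d j).
Proof.
move=> q01 cC cd; have /andP[q0 q1] := q01.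
have dC j : `|d j| <= C * q ^+ j.
  have cn : `|c t j| @[t --> F] --> `|d j| by apply: cvg_norm; exact: cd.
  rewrite -(cvg_lim _ cn)//; apply: limr_le; first exact: cvgP cn.
  by apply: filterS cC => t; exact.
apply/cvgrPdist_le => e e0.
have cq : C * q ^+ J / (1 - q) @[J --> \oo] --> (0 : R).
  rewrite -[X in _ --> X](mul0r (1 - q)^-1) -[X in X / _](mulr0 C).
  apply: cvgM; last exact: cvg_cst.
  apply: cvgM; first exact: cvg_cst.
  by apply: cvg_expr; rewrite ger0_norm.
have e3 : 0 < e / 3 by rewrite divr_gt0.
move/cvgrPdist_le : cq => /(_ _ e3)[J _ HJ].
have {}HJ : C * q ^+ J / (1 - q) <= e / 3.
  by have := HJ J (leqnn _); rewrite /= sub0r normrN; apply: le_trans; exact: ler_norm.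
have cs : \sum_(j < J) c t j @[t --> F] --> \sum_(j < J) d j.
  by apply: cvg_big => [|k _]; [exact: add_continuous|exact: cd].
move/cvgrPdist_le : cs => /(_ _ e3) cs.
near=> t.
have h1 : `|\sum_(j < J) d j - \sum_(j < J) c t j| <= e / 3 by near: t.
have h2 : `|limn (fun J => \sum_(j < J) d j) - \sum_(j < J) d j| <= e / 3.
  exact: le_trans (geometric_majorant_tail J q01 dC) HJ.
have h3 : `|limn (fun J => \sum_(j < J) c t j) - \sum_(j < J) c t j| <= e / 3.
  apply: le_trans HJ; apply: geometric_majorant_tail => //.
  by near: t.
set x := limn _ in h2 *; set y := limn _ in h3 *.
have -> : x - y = (x - \sum_(j < J) d j) + (\sum_(j < J) d j - \sum_(j < J) c t j)
   - (y - \sum_(j < J) c t j) by ring.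
rewrite (le_trans (ler_normB _ _))// (le_trans (lerD (ler_normD _ _) (lexx _)))//.
rewrite (le_trans (lerD (lerD h2 h1) h3))//.
by rewrite le_eqVlt; apply/orP; left; apply/eqP; field.
Unshelve. all: by end_near. Qed.

(* The choice r = 1 - K / n with K^a = 2 s + 1 makes the majorant of
   [grunwald_term_1D_le] uniform in n when l = s n^(-a). *)
Lemma grunwald_scaling (R : realType) (a s : R) : 0 < a -> 0 <= s ->
  exists C, \forall n \near \oo, exists r,
    [/\ 0 < r < 1, s * n%:R `^ (- a) * (1 - r) `^ (- a) <= 2^-1 & (r ^+ n)^-1 <= C].
Proof.
move=> a0 s0; set K := (2 * s + 1) `^ a^-1.
have s1 : 0 < 2 * s + 1 by rewrite ltr_wpDl// mulr_ge0.
have K0 : 0 < K by rewrite powR_gt0.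
have Ka : K `^ a = 2 * s + 1 by rewrite /K -powRrM mulVf ?gt_eqF// powRr1// ltW.
exists (expR (2 * K)); near=> n.
have n2K : 2 * K <= n%:R by near: n; exact: nbhs_infty_ger.
have n0 : 0 < n%:R :> R by rewrite (lt_le_trans _ n2K)// mulr_gt0.
pose k := K / n%:R.
have k0 : 0 < k by rewrite divr_gt0.
have k2 : k <= 2^-1 by rewrite ler_pdivrMr//; lra.
exists (1 - k); split.
- by apply/andP; split; lra.
(* The powers of n cancel and leave s / K^a = s / (2 s + 1). *)
- rewrite opprB addrC subrK -mulrA -powRM ?(ltW n0) ?(ltW k0)//.
  rewrite /k [n%:R * _]mulrC divfK ?gt_eqF// powRN Ka ler_pdivrMr//; lra.
(* For k <= 1/2 one has (1 + 2 k) (1 - k) >= 1, hence (1 - k)^-1 <= expR (2 k), whose n-th power is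
   expR (2 K). *)
- have kn : 2 * k * n%:R = 2 * K by rewrite /k -mulrA divfK ?gt_eqF.
  rewrite -kn expRM_natr -exprVn lerXn2r ?nnegrE ?invr_ge0 ?expR_ge0//; first lra.
  rewrite -(mul1r (_^-1)) ler_pdivrMr; last lra.
  have := expR_ge1Dx (2 * k) => h.
  have := ler_wpM2r (_ : 0 <= 1 - k) h => /(_ ltac:(lra)); apply: le_trans.
  by nra.
Unshelve. all: by end_near. Qed.

Lemma cvg_grunwald_term (R : realType) (a s : R) j : 0 < a ->
  grunwald_term a n (s * n%:R `^ (- a)) 1 j @[n --> \oo] -->
  (- s) ^+ j / Gamma (1 + j%:R * a).
Proof.
move=> a0; have ja0 : 0 <= j%:R * a by rewrite mulr_ge0// ltW.
have H : (- s) ^+ j * (rbin n (1 + j%:R * a) / n%:R `^ (j%:R * a)) @[n --> \oo] -->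
    (- s) ^+ j / Gamma (1 + j%:R * a).
  by apply: cvgM; [exact: cvg_cst|exact: cvg_rbin].
apply: cvg_trans H; apply: near_eq_cvg; near=> n.
rewrite /grunwald_term -mulNr exprMn -[_ `^ _ ^+ _]powR_mulrn ?powR_ge0//.
by rewrite -powRrM mulNr powRN [a * _]mulrC; ring.
Unshelve. all: by end_near. Qed.

(** Exponent 1 means x = 0 in [grunwald_term_1D_le], so the factor (1 - r)^(- x), which could grow
    with n, is 1. *)
Lemma grunwald_term1_majorant (R : realType) (a s : R) : 0 < a -> 0 <= s ->
  exists C, \forall n \near \oo, forall j,
    `|grunwald_term a n (s * n%:R `^ (- a)) 1 j| <= C * 2^-1 ^+ j.
Proof.
move=> a0 s0; have [C HC] := grunwald_scaling a0 s0; exists C.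
apply: filterS HC => n [r [r01 q2 rC]] j.
have := grunwald_term_1D_le n j (ltW a0) (_ : 0 <= s * n%:R `^ (- a)) r01 (lexx 0).
rewrite addr0 oppr0 powRr0 mulr1 => /(_ (mulr_ge0 s0 (powR_ge0 _ _)))/le_trans; apply.
rewrite ler_pM ?invr_ge0 ?exprn_ge0 ?mulr_ge0 ?powR_ge0//.
  by case/andP: r01 => /ltW.
by rewrite lerXn2r ?nnegrE ?mulr_ge0 ?powR_ge0 ?invr_ge0.
Qed.

(** Obtained as the limit n -> oo of the bounds on [grunwald_term], in place of an estimate of the
    growth of Gamma. *)
Lemma mittag_leffler_majorant (R : realType) (a s : R) : 0 < a -> 0 <= s ->
  exists C, forall z j, `|z| <= s -> `|z ^+ j / Gamma (1 + j%:R * a)| <= C * 2^-1 ^+ j.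
Proof.
move=> a0 s0; have [C HC] := grunwald_term1_majorant a0 s0.
exists C => z j zs.
have G0 : 0 < Gamma (1 + j%:R * a) by rewrite Gamma_gt0// mulr_ge0// ltW.
apply: (@le_trans _ _ `|(- s) ^+ j / Gamma (1 + j%:R * a)|).
  rewrite !normrM !normrX normrN (ger0_norm s0) ler_wpM2r//.
  by rewrite lerXn2r ?nnegrE.
have cn : `|grunwald_term a n (s * n%:R `^ (- a)) 1 j| @[n --> \oo] -->
    `|(- s) ^+ j / Gamma (1 + j%:R * a)| by apply: cvg_norm; exact: cvg_grunwald_term.
rewrite -(cvg_lim _ cn)//; apply: limr_le; first exact: cvgP cn.
by apply: filterS HC => n; exact.
Qed.

Lemma half_itv (R : realType) : 0 <= (2^-1 : R) < 1.
Proof. by apply/andP; split; lra. Qed.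

Lemma cvg_grunwald_mittag_leffler (R : realType) (a s : R) : 0 < a -> 0 <= s ->
  grunwald a n (s * n%:R `^ (- a)) 1 @[n --> \oo] --> mittag_leffler a (- s).
Proof.
move=> a0 s0; have [C HC] := grunwald_term1_majorant a0 s0.
apply: (tannery_geometric (half_itv R) HC
  (d := fun j => (- s) ^+ j / Gamma (1 + j%:R * a))) => j.
exact: cvg_grunwald_term.
Qed.

Lemma mittag_lefflerN_ge0 (R : realType) (a s : R) : 0 < a <= 1 -> 0 <= s ->
  0 <= mittag_leffler a (- s).
Proof.
move=> /andP[a0 a1] s0; have cE := cvg_grunwald_mittag_leffler a0 s0.
have [C HC] := grunwald_scaling a0 s0.
rewrite -(cvg_lim _ cE)//; apply: limr_ge; first exact: cvgP cE.
apply: filterS HC => n [r [r01 q2 _]].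
apply: (@grunwald_ge0 _ a _ r) => //; first by rewrite ltW.
- by rewrite mulr_ge0// powR_ge0.
- by rewrite (le_lt_trans q2)//; lra.
Qed.

Lemma mittag_lefflerN_le (R : realType) (a s : R) : 0 < a <= 1 -> 0 <= s ->
  mittag_leffler a (- s) <= (1 + s / Gamma (1 + a))^-1.
Proof.
move=> /andP[a0 a1] s0; have cE := cvg_grunwald_mittag_leffler a0 s0.
have [C HC] := grunwald_scaling a0 s0.
have G0 := Gamma_gt0 (ltW a0).
rewrite -[leRHS]mul1r ler_pdivlMr; last by rewrite ltr_pwDl// divr_ge0// ltW.
have cR : grunwald a n (s * n%:R `^ (- a)) 1 *
    (1 + s * (rbin n (1 + a) / n%:R `^ a)) @[n --> \oo] -->
    mittag_leffler a (- s) * (1 + s / Gamma (1 + a)).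
  apply: cvgM cE _; apply: cvgD; first exact: cvg_cst.
  by apply: cvgM; [exact: cvg_cst|exact: cvg_rbin (ltW a0)].
rewrite -(cvg_lim _ cR)//; apply: limr_le; first exact: cvgP cR.
apply: filterS HC => n [r [r01 q2 _]].
rewrite [rbin _ _ / _]mulrC mulrA -powRN.
apply: (@grunwald1_le _ a _ r) => //; first by rewrite ltW.
- by rewrite mulr_ge0// powR_ge0.
- by rewrite (le_lt_trans q2)//; lra.
Qed.

Lemma continuous_mittag_leffler (R : realType) (a : R) : 0 < a ->
  continuous (mittag_leffler a).
Proof.
move=> a0 z.
have s0 : 0 <= `|z| + 1 by rewrite addr_ge0.
have [C HC] := mittag_leffler_majorant a0 s0.
apply: (tannery_geometric (F := nbhs z) (half_itv R) (C := C)
  (c := fun y j => y ^+ j / Gamma (1 + j%:R * a))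
  (d := fun j => z ^+ j / Gamma (1 + j%:R * a))).
- near=> y => j; apply: HC.
  rewrite -(subrK z y) (le_trans (ler_normD _ _))// addrC lerD2l.
  by near: y; apply: cvgr_distC_le => //; exact: cvg_id.
- move=> j; apply: cvgM; last exact: cvg_cst.
  exact: exprn_continuous.
Unshelve. all: by end_near. Qed.

(** * The self-similar profile *)

Lemma ge0_integral_scale (R : realType) (c : R) (G : R -> R) :
  0 < c -> continuous G -> (forall x, 0 <= G x) ->
  (\int[@lebesgue_measure R]_x (G x)%:E =
   \int[@lebesgue_measure R]_x (G (c * x))%:E * c%:E)%E.
Proof.
move=> c0 cG G0.
have d (x : R) : is_derive x 1 (fun y : R => c * y) c.
  have := is_deriveZ c (is_derive_id x (1 : R)).
  by rewrite /GRing.scale/= mulr1.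
have dE : (fun y : R => c * y)^`()%classic = cst c.
  by apply/funext => x; rewrite derive1E; apply: derive_val; exact: d.
have cGc : continuous (fun x => G (c * x)).
  move=> x; apply: continuous_comp; last exact: cG.
  exact: mulrl_continuous.
rewrite (@increasing_ge0_integration_by_substitutionT _ (fun y => c * y) G)//.
- rewrite -ge0_integralZr//.
  + by apply: eq_integral => x _; rewrite dE.
  + by apply/measurable_EFinP; exact: continuous_measurable_fun.
  + by move=> x _; rewrite lee_fin.
  + by rewrite lee_fin ltW.
- by move=> x y xy; rewrite ltr_pM2l.
- by rewrite dE; exact: cst_continuous.
- by rewrite dE; exact: is_cvg_cst.
- by rewrite dE; exact: is_cvg_cst.
- exact: gt0_cvgMrNy.
- exact: gt0_cvgMry.
Qed.

Lemma ge0_Rintegral_scale (R : realType) (c : R) (G : R -> R) :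
  0 < c -> continuous G -> (forall x, 0 <= G x) ->
  (@lebesgue_measure R).-integrable setT (EFin \o G) ->
  (@lebesgue_measure R).-integrable setT (EFin \o (fun x => G (c * x))) /\
  \int[@lebesgue_measure R]_x G (c * x) = c^-1 * \int[@lebesgue_measure R]_x G x.
Proof.
move=> c0 cG G0 iG; have E := ge0_integral_scale c0 cG G0.
have cGc : continuous (fun x => G (c * x)).
  move=> x; apply: continuous_comp; last exact: cG.
  exact: mulrl_continuous.
have fG : (\int[@lebesgue_measure R]_x (G x)%:E)%E \is a fin_num.
  exact: integrable_fin_num.
have iGc : (@lebesgue_measure R).-integrable setT (EFin \o (fun x => G (c * x))).
  apply/integrableP; split.
    by apply/measurable_EFinP; exact: continuous_measurable_fun.
  under eq_integral => x _ do rewrite /= ger0_norm//.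
  rewrite ltNge leye_eq; apply/eqP => H.
  by move: fG; rewrite E H gt0_mulye// lte_fin.
split => //; rewrite /Rintegral E fineM//; last exact: integrable_fin_num.
by rewrite mulrC mulfK ?gt_eqF.
Qed.

(** G is the difference of G + |G| and |G|, which are continuous, nonnegative and integrable. *)
Lemma Rintegral_scale (R : realType) (c : R) (G : R -> R) :
  0 < c -> continuous G ->
  (@lebesgue_measure R).-integrable setT (EFin \o G) ->
  \int[@lebesgue_measure R]_x G (c * x) = c^-1 * \int[@lebesgue_measure R]_x G x.
Proof.
move=> c0 cG iG.
have cA : continuous (fun x => `|G x|).
  by move=> x; apply: continuous_comp; [exact: cG|exact: norm_continuous].
have iA : (@lebesgue_measure R).-integrable setT (EFin \o (fun x => `|G x|)).
  exact: integrable_norm.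
have cS : continuous (fun x => G x + `|G x|).
  by move=> x; apply: cvgD; [exact: cG|exact: cA].
have iS : (@lebesgue_measure R).-integrable setT (EFin \o (fun x => G x + `|G x|)).
  by apply: integrable_add.
have A0 x : 0 <= `|G x| by [].
have S0 x : 0 <= G x + `|G x| by rewrite -lerBlDr sub0r lerNl -normrN ler_norm.
have [iA' EA] := ge0_Rintegral_scale c0 cA A0 iA.
have [iS' ES] := ge0_Rintegral_scale c0 cS S0 iS.
have E (y : R -> R) : \int[@lebesgue_measure R]_x G (y x) =
    \int[@lebesgue_measure R]_x ((G (y x) + `|G (y x)|) - `|G (y x)|).
  by apply: eq_Rintegral => x _; rewrite addrK.
rewrite E RintegralB//.
rewrite ES EA (E id) RintegralB//=; ring.
Qed.

Lemma integrable_oneDsqrV (R : realType) :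
  (@lebesgue_measure R).-integrable setT (EFin \o (fun x : R => (oneDsqr x)^-1)).
Proof.
have p0 (x : R) : 0 <= (oneDsqr x)^-1.
  by rewrite invr_ge0 (le_trans _ (oneDsqr_ge1 x)).
apply/integrableP; split.
  apply/measurable_EFinP; apply: continuous_measurable_fun; exact: continuous_oneDsqrV.
under eq_integral => x _ do rewrite /= ger0_norm//.
rewrite (ge0_symfun_integralT p0 (@continuous_oneDsqrV R)); last first.
  by move=> x; rewrite /= /oneDsqr sqrrN.
rewrite (_ : [set x : R | 0 <= x] = `[0, +oo[%classic); last first.
  by apply/seteqP; split => x /=; rewrite in_itv/= andbT.
by rewrite integral0y_oneDsqr -EFinM ltry.
Qed.

Section profile.
Context {R : realType} (a : R) (a01 : 0 < a <= 1).

(** The Fourier transform of the profile F. *)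
Let h (w : R) : R := mittag_leffler a (- (w ^+ 2)).

Let h_ge0 w : 0 <= h w.
Proof. by apply: mittag_lefflerN_ge0 => //; exact: sqr_ge0. Qed.

Let h_continuous : continuous h.
Proof.
move=> w; apply: continuous_comp; last first.
  by apply: continuous_mittag_leffler; case/andP: a01.
by apply: continuous_comp; [exact: exprn_continuous|exact: opp_continuous].
Qed.

Let h_integrable : (@lebesgue_measure R).-integrable setT (EFin \o h).
Proof.
have [a0 a1] := andP a01.
have G0 := Gamma_gt0 (ltW a0).
(* With G = Gamma (1 + a), the constant 1 + G suffices since 1 + w^2 <= (1 + G) (1 + w^2 / G). *)
have i := integrableZl (@measurableT _ _) (1 + Gamma (1 + a)) (integrable_oneDsqrV R).
apply: le_integrable i => //.
  by apply/measurable_EFinP; exact: continuous_measurable_fun.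
move=> w _ /=; rewrite lee_fin.
have o0 : 0 < oneDsqr w by rewrite (lt_le_trans _ (oneDsqr_ge1 w)).
have G1 : 0 < 1 + Gamma (1 + a) by rewrite addr_gt0.
rewrite !ger0_norm//; last by rewrite mulr_ge0 ?invr_ge0// ltW.
rewrite (le_trans (mittag_lefflerN_le a01 (sqr_ge0 w)))//.
have w2 := sqr_ge0 w.
rewrite -[(1 + Gamma _)]invrK -invfM lef_pV2 ?posrE ?mulr_gt0 ?invr_gt0//.
  rewrite ler_pdivrMl// /oneDsqr mulrDl mul1r mulrDr mulr1.
  rewrite [Gamma _ * (_ / _)]mulrC divfK ?gt_eqF//.
  have : 0 <= w ^+ 2 / Gamma (1 + a) by rewrite divr_ge0// ltW.
  lra.
by rewrite ltr_pwDl// divr_ge0// ltW.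
Qed.

Let hcos (y w : R) := h w * cos (w * y).

Let hcos_continuous y : continuous (hcos y).
Proof.
move=> w; apply: cvgM; first exact: h_continuous.
by apply: continuous_comp; [exact: mulrr_continuous|exact: continuous_cos].
Qed.

Let hcos_le y w : `|hcos y w| <= h w.
Proof.
by rewrite /hcos normrM ger0_norm// ler_piMr// ler_norml cos_geN1 cos_le1.
Qed.

Let hcos_integrable y : (@lebesgue_measure R).-integrable setT (EFin \o hcos y).
Proof.
apply: le_integrable h_integrable => //.
  by apply/measurable_EFinP; exact: continuous_measurable_fun.
by move=> w _ /=; rewrite lee_fin (le_trans (hcos_le y w))// ler_norm.
Qed.

Let profileFE y : profileF a y = (2 * pi)^-1 * \int[@lebesgue_measure R]_w hcos y w.
Proof.
rewrite /profileF /fundZ; congr (_ * _); apply: eq_Rintegral => w _.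
by rewrite powR1 mulr1.
Qed.

(** Self-similarity, by substituting c w for w with c = t^(a/2), so that c^2 = t^a. *)
Lemma fundZ_scale x t : 0 < t ->
  t `^ (a / 2) * fundZ a x t = profileF a (x / t `^ (a / 2)).
Proof.
move=> t0; set c := t `^ (a / 2).
have c0 : 0 < c by rewrite powR_gt0.
have ta : t `^ a = c ^+ 2.
  by rewrite -powR_mulrn ?ltW// -powRrM divfK// pnatr_eq0.
rewrite profileFE /fundZ.
have -> : \int[@lebesgue_measure R]_w
    (mittag_leffler a (- (w ^+ 2 * t `^ a)) * cos (w * x)) =
    \int[@lebesgue_measure R]_w hcos (x / c) (c * w).
  apply: eq_Rintegral => w _; rewrite /hcos /h ta exprMn [w ^+ 2 * _]mulrC.
  by congr (_ * cos _); field; rewrite gt_eqF.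
rewrite Rintegral_scale// mulrCA; congr (_ * _).
by rewrite mulrA divff ?gt_eqF// mul1r.
Qed.

Lemma profileF_bounded : exists B : R, forall y, `|profileF a y| <= B.
Proof.
exists ((2 * pi)^-1 * \int[@lebesgue_measure R]_w h w) => y.
have p0 : 0 <= (2 * pi : R)^-1 by rewrite invr_ge0 mulr_ge0// pi_ge0.
rewrite profileFE normrM ger0_norm// ler_wpM2l//.
rewrite (le_trans (le_normr_Rintegral _ _))//.
apply: le_Rintegral => //.
exact: integrable_norm.
Qed.

Lemma continuous_profileF : continuous (profileF a).
Proof.
move=> y; rewrite (_ : profileF a = fun y =>
  (2 * pi)^-1 * \int[@lebesgue_measure R]_w hcos y w); last first.
  by apply/funext => z; rewrite profileFE.
apply: cvgM; first exact: cvg_cst.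
have hc : \forall w \ae (@lebesgue_measure R), setT w ->
    {in (`]y - 1, y + 1[%classic : set R), continuous (hcos ^~ w)}.
  apply: aeW => w _ z _; apply: cvgM; first exact: cvg_cst.
  by apply: continuous_comp; [exact: mulrl_continuous|exact: continuous_cos].
have hb z : (`]y - 1, y + 1[%classic : set R) z ->
    \forall w \ae (@lebesgue_measure R), setT w -> `|hcos z w| <= h w.
  by move=> _; apply: aeW => w _; exact: hcos_le.
apply: (continuity_under_integral _ (fun z _ => hcos_integrable z) hc
  h_integrable hb) => //.
by rewrite inE/= in_itv/=; apply/andP; split; lra.
Qed.

End profile.

(** * Convergence near the origin *)

Lemma measurable_norm_gt (R : realType) (r : R) : measurable [set y : R | r < `|y|].
Proof.
rewrite (_ : [set y : R | r < `|y|] = Num.norm @^-1` `]r, +oo[%classic).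
  by rewrite -[X in measurable X]setTI; exact: normr_measurable.
by apply/seteqP; split => y /=; rewrite in_itv/= andbT.
Qed.

Lemma integral_tail_cvg0 (R : realType) (u : R -> R) :
  (@lebesgue_measure R).-integrable setT (EFin \o u) ->
  (\int[@lebesgue_measure R]_x (`|u x| * \1_[set y | n%:R < `|y|] x)%:E)%E
    @[n --> \oo] --> 0%E.
Proof.
move=> iu.
have mu : measurable_fun setT u by apply/measurable_EFinP; exact: measurable_int iu.
rewrite -[X in _ --> X](integral0 (@lebesgue_measure R) setT).
apply: (@dominated_cvg _ _ _ (@lebesgue_measure R) setT _
  (fun n x => (`|u x| * \1_[set y | n%:R < `|y|] x)%:E) (cst 0%E)
  (EFin \o (fun x => `|u x|))) => //.
- move=> n; apply/measurable_EFinP; apply: measurable_funM.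
    exact: measurableT_comp.
  by apply: measurable_indic; exact: measurable_norm_gt.
- move=> x _; apply: cvg_near_cst; near=> n.
  rewrite indicE memNset ?mulr0//= => /ltW; apply/negP; rewrite -ltNge.
  by near: n; exact: nbhs_infty_gtr.
- exact: integrable_norm.
- move=> n x _; rewrite lee_fin normrM normr_id ler_piMr//.
  by rewrite indicE; case: (_ \in _); rewrite ?normr1 ?normr0.
Unshelve. all: by end_near. Qed.

Section mild_solution.
Context {R : realType} (a : R) (u0 : R -> R).
Hypotheses (a01 : 0 < a <= 1) (u0_ge0 : forall x, 0 <= u0 x)
  (u0_int : (@lebesgue_measure R).-integrable setT (fun x => (u0 x)%:E)).

Let M : R := \int[@lebesgue_measure R]_x u0 x.

(** Both d and L are independent of x and t, and only the scale t^(a/2) enters; the growth of g is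
    compared with this scale later. *)
Lemma mild_sol_near_origin (e : R) : 0 < e -> exists2 d : R, 0 < d & exists L : R,
  forall x t : R, 0 < t -> `|x| <= d * t `^ (a / 2) -> L <= d * t `^ (a / 2) ->
  `|t `^ (a / 2) * mild_sol a u0 x t - M * profileF a 0| <= e.
Proof.
move=> e0.
have mu0 : measurable_fun setT u0 by apply/measurable_EFinP; exact: measurable_int u0_int.
have [B0 FB0] := profileF_bounded a01.
pose B : R := `|B0| + 1.
have B_gt0 : 0 < B by rewrite ltr_wpDl.
have FB y : `|profileF a y| <= B.
  by rewrite (le_trans (FB0 y))// (le_trans (ler_norm _))// lerDl.
have M0 : 0 <= M by apply: Rintegral_ge0.
have M1 : 0 < M + 1 by rewrite ltr_wpDl.
(* Half of e goes to |y| <= n, where F varies by at most [e / 2 / (M + 1)] against a mass M; the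
   other half goes to the tail, where F varies by at most 2 B. *)
have e1 : 0 < e / 2 / (M + 1) by rewrite !divr_gt0.
have e2 : 0 < e / 2 / (2 * B) by rewrite !divr_gt0// mulr_gt0.
have Fc := @continuous_profileF _ _ a01 0.
move/cvgrPdist_le : Fc => /(_ _ e1)[d /= d0 Hd].
have := integral_tail_cvg0 u0_int => /fine_cvgP[_ /cvgrPdist_le/(_ _ e2)[n _ Hn]].
have {Hn} := Hn n (leqnn n); rewrite /= sub0r normrN => Hn.
(* With |x| and |y| both at most d c / 3, the point (x - y) / c lies strictly inside the ball of
   radius d. *)
exists (d / 3); first by rewrite divr_gt0.
exists n%:R => x t t0 xd Ld.
set c := t `^ (a / 2) in xd Ld *.
have c0 : 0 < c by rewrite powR_gt0.
pose K y := profileF a ((x - y) / c).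
have cK : continuous K.
  move=> y; apply: (@continuous_comp _ _ _ (fun y => (x - y) / c) (profileF a));
    last exact: continuous_profileF.
  apply: cvgM; last exact: cvg_cst.
  by apply: cvgB; [exact: cvg_cst|exact: cvg_id].
have mK : measurable_fun setT K by exact: continuous_measurable_fun.
have iK : (@lebesgue_measure R).-integrable setT (EFin \o (fun y => K y * u0 y)).
  apply: (le_integrable _ _ _ (integrableZl measurableT B u0_int)) => //.
    by apply/measurable_EFinP; exact: measurable_funM.
  move=> y _ /=; rewrite lee_fin normrM [leRHS]normrM ler_wpM2r//.
  exact: (le_trans (FB ((x - y) / c)) (ler_norm B)).
have iF0 : (@lebesgue_measure R).-integrable setT
    (EFin \o (fun y => profileF a 0 * u0 y)).
  by apply: integrable_mull.
have -> : c * mild_sol a u0 x t - M * profileF a 0 =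
    \int[@lebesgue_measure R]_y (K y * u0 y - profileF a 0 * u0 y).
  rewrite RintegralB// [X in _ = _ - X]RintegralZl// -/M [M * _]mulrC; congr (_ - _).
  rewrite /mild_sol; have cN0 : c != 0 by rewrite gt_eqF.
  transitivity (c * \int[@lebesgue_measure R]_y (c^-1 * (K y * u0 y))).
    congr (_ * _); apply: eq_Rintegral => y _.
    by rewrite /K -fundZ_scale// -/c !mulrA mulVf// mul1r.
  by rewrite RintegralZl// mulrA divff// mul1r.
have iD : (@lebesgue_measure R).-integrable setT
    (EFin \o (fun y => K y * u0 y - profileF a 0 * u0 y)).
  by apply: integrable_sub.
rewrite (le_trans (le_normr_Rintegral _ _))//.
pose T y := `|u0 y| * \1_[set y | n%:R < `|y|] y.
have mT : measurable [set y : R | n%:R < `|y|] by exact: measurable_norm_gt.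
have iT : (@lebesgue_measure R).-integrable setT (EFin \o T).
  apply: (le_integrable _ _ _ u0_int) => //.
    apply/measurable_EFinP; apply: measurable_funM; first exact: measurableT_comp.
    exact: measurable_indic.
  move=> y _ /=; rewrite lee_fin normrM normr_id ler_piMr//.
  by rewrite indicE; case: (_ \in _); rewrite ?normr1 ?normr0.
have i1 : (@lebesgue_measure R).-integrable setT
    (EFin \o (fun y => e / 2 / (M + 1) * u0 y)).
  by apply: integrable_mull.
have i2 : (@lebesgue_measure R).-integrable setT (EFin \o (fun y => 2 * B * T y)).
  by apply: integrable_mull.
apply: (@le_trans _ _ (\int[@lebesgue_measure R]_y
  (e / 2 / (M + 1) * u0 y + 2 * B * T y))).
  apply: le_Rintegral => //.
  - exact: integrable_norm.
  - by apply: integrable_add.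
  move=> y _; rewrite -mulrBl normrM (ger0_norm (u0_ge0 y)).
  rewrite /T (ger0_norm (u0_ge0 y)) [u0 y * _]mulrC mulrA -mulrDl ler_wpM2r//.
  have [yn|yn] := ltP n%:R `|y|.
    rewrite indicE mem_set//= mulr1 (le_trans (ler_normB _ _))//.
    have := lerD (FB ((x - y) / c)) (FB 0).
    by have := ltW e1; rewrite /K; lra.
  rewrite indicE memNset; last by rewrite /= ltNge yn.
  rewrite mulr0 addr0 distrC /K; apply: Hd => /=.
  rewrite sub0r normrN normrM normfV (gtr0_norm c0) ltr_pdivrMr//.
  rewrite (le_lt_trans (ler_normB _ _))//.
  have := mulr_gt0 d0 c0; lra.
rewrite RintegralD// RintegralZl// RintegralZl// -/M.
have h1 : e / 2 / (M + 1) * M <= e / 2.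
  rewrite mulrAC ler_pdivrMr// ler_wpM2l ?divr_ge0 ?(ltW e0)//; lra.
have h2 : 2 * B * \int[@lebesgue_measure R]_y T y <= e / 2.
  rewrite mulrC -ler_pdivlMr ?mulr_gt0//; apply: le_trans Hn; exact: ler_norm.
by rewrite [leRHS]splitr lerD.
Qed.

End mild_solution.

(** * From uniform bounds to weighted L^p norms *)

Lemma ge0_integral_le_indic (R : realType) (f : R -> \bar R) (k b : R) :
  0 <= k -> 0 <= b -> (forall x, (0 <= f x)%E) ->
  (forall x, (f x <= (k * \1_(`[- b, b]%classic : set R) x)%:E)%E) ->
  (\int[@lebesgue_measure R]_x f x <= (k * (2 * b))%:E)%E.
Proof.
move=> k0 b0 f0 fk.
have -> : (k * (2 * b))%:E =
    (\int[@lebesgue_measure R]_x (k * \1_(`[- b, b]%classic : set R) x)%:E)%E.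
  under eq_integral do rewrite EFinM.
  rewrite ge0_integralZl//; last first.
    by apply/measurable_EFinP; exact: measurable_indic.
  rewrite integral_indic// setIT/= lebesgue_measure_itv/= lte_fin EFinM.
  congr (_ * _)%E; case: ltP => [_|bb]; first by rewrite -EFinB; congr EFin; ring.
  by congr EFin; lra.
(* The nonnegative integral is a supremum over the simple functions below the integrand, so
   monotonicity holds for an arbitrary f. *)
rewrite !ge0_integralTE//; last by move=> x; rewrite lee_fin mulr_ge0.
apply: ereal_sup_le; apply: image_subset => h hf x.
exact: le_trans (hf x) (fk x).
Qed.

(** As A lies in an interval of length 2 k g, the prefactor cancels g^(1/p) and leaves e (2
    k)^(1/p); the factor 1 + 2 k bounds this for all p >= 1 at once. *)
Lemma LpNormOn_le (R : realType) (p : \bar R) (A : set R) (f : R -> R) (g k e : R) :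
  (1 <= p)%E -> 0 < g -> 0 < k -> 0 <= e ->
  (forall x, A x -> `|x| <= k * g) -> (forall x, A x -> `|f x| <= e) ->
  ((inv_p_pow g p)%:E * LpNormOn p A f <= (e * (1 + 2 * k))%:E)%E.
Proof.
move=> p1 g0 k0 e0 Ag Af; rewrite /LpNormOn unlock.
have fe x : `|\1_A x * f x| <= e.
  rewrite indicE; case: (boolP (x \in A)) => [/set_mem Ax|_].
    by rewrite mul1r Af.
  by rewrite mul0r normr0.
case: p p1 => [r|_|//].
- rewrite lee_fin => r1; have r0 : 0 < r by rewrite (lt_le_trans _ r1).
  have rV0 : 0 < r^-1 by rewrite invr_gt0.
  have kg : 0 < k * g by rewrite mulr_gt0.
  set I := (\int[_]_x _)%E.
  have I0 : (0 <= I)%E by apply: integral_ge0 => x _; exact: poweR_ge0.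
  have Ie : (I <= (e `^ r * (2 * (k * g)))%:E)%E.
    apply: ge0_integral_le_indic; rewrite ?powR_ge0 ?(ltW kg)//.
      by move=> x; exact: poweR_ge0.
    move=> x; rewrite /= lee_fin.
    rewrite indicE; case: (boolP (x \in A)) => [/set_mem Ax|_]; last first.
      by rewrite mul0r normr0 powR0 ?gt_eqF// mulr_ge0// powR_ge0.
    rewrite mul1r indicE mem_set/=; last by rewrite in_itv/= -ler_norml Ag.
    by rewrite mulr1 ge0_ler_powR ?nnegrE ?(ltW r0)// Af.
  apply: (@le_trans _ _ ((g `^ (- r^-1))%:E * ((e `^ r * (2 * (k * g))) `^ r^-1)%:E)%E).
    rewrite lee_wpmul2l ?lee_fin ?powR_ge0//= -poweR_EFin.
    apply: gt0_ler_poweR => //; rewrite ?(ltW rV0)// in_itv/= leey andbT//.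
    by rewrite lee_fin !mulr_ge0 ?powR_ge0// ltW.
  rewrite -EFinM lee_fin.
  rewrite powRM ?powR_ge0//; last by rewrite mulr_ge0// ltW.
  rewrite -powRrM divff ?gt_eqF// powRr1// [2 * (k * g)]mulrA.
  rewrite [(2 * k * g) `^ _]powRM ?mulr_ge0 ?(ltW k0) ?(ltW g0)//.
  rewrite powRN; have gN0 : g `^ r^-1 != 0 by rewrite gt_eqF// powR_gt0.
  have -> : (g `^ r^-1)^-1 * (e * ((2 * k) `^ r^-1 * g `^ r^-1)) =
      e * (2 * k) `^ r^-1 by field.
  rewrite ler_wpM2l//.
  have k21 : 1 <= 1 + 2 * k by rewrite lerDl mulr_ge0// ltW.
  apply: (@le_trans _ _ ((1 + 2 * k) `^ r^-1)).
    apply: ge0_ler_powR;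
      rewrite ?nnegrE ?(ltW rV0) ?mulr_ge0 ?addr_ge0 ?mulr_ge0 ?(ltW k0)//.
    by rewrite lerDr.
  by apply: ler1_powR => //; rewrite invf_le1.
- rewrite /= mul1e.
  have ek : e <= e * (1 + 2 * k) by rewrite ler_peMr// lerDl mulr_ge0// ltW.
  (* At p = +oo the norm is an essential supremum if the whole space has positive measure, and 0
     otherwise. *)
  case: ifP => _; last by rewrite lee_fin (le_trans e0).
  by apply/ess_supP; apply: aeW => x; rewrite /= lee_fin (le_trans (fe x)).
Qed.

Set Strict Implicit. Unset Implicit Arguments.

Theorem theorem4p3 (R : realType) (a : R) (p : \bar R)
    (u0 : R -> R) (g : R -> R) (nu mu : R) :
  0 < a < 1 ->
  (1 <= p)%E ->
  measurable_fun [set: R] u0 ->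
  (@lebesgue_measure R).-integrable [set: R] (fun x => (u0 x)%:E) ->
  (forall x, 0 <= u0 x) ->
  ~ {ae (@lebesgue_measure R), forall x, u0 x = 0} ->
  (forall t, 0 < t -> 0 < g t) ->
  g t @[t --> +oo] --> +oo ->
  g t / t `^ (a / 2) @[t --> +oo] --> 0 ->
  0 < nu -> nu < mu ->
  let M := \int[(@lebesgue_measure R)]_(x in [set: R]) u0 x in
  ((inv_p_pow (g t) p)%:E *
     LpNormOn p [set x | (nu < `|x| / g t < mu)%R]
       (fun x => t `^ (a / 2) * mild_sol a u0 x t - M * profileF a 0)%R)%E
    @[t --> +oo] --> 0%E.
Proof.
move=> a01 p1 _ iu u00 _ g0 gy gc0 nu0 numu M.
have a01' : 0 < a <= 1 by case/andP: a01 => -> /ltW.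
have mu0 : 0 < mu := lt_trans nu0 numu.
have main (e : R) : 0 < e -> \forall t \near +oo,
   (0 <= (inv_p_pow (g t) p)%:E *
     LpNormOn p [set x | (nu < `|x| / g t < mu)%R]
       (fun x => t `^ (a / 2) * mild_sol a u0 x t - M * profileF a 0)%R <= e%:E)%E.
  move=> e0.
  have k0 : 0 < 1 + 2 * mu by rewrite addr_gt0// mulr_gt0.
  (* Compensates the factor of [LpNormOn_le] with k = mu. *)
  have e1 : 0 < e / (1 + 2 * mu) by rewrite divr_gt0.
  have [d d0 [L HL]] := mild_sol_near_origin a01' u00 iu e1.
  (* Eventually g is at most d / mu times t^(a/2) and at least L / mu, which places mu g between L
     and d t^(a/2). *)
  have dm : 0 < d / mu by rewrite divr_gt0.
  move/cvgrPdist_le : gc0 => /(_ _ dm) gc0.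
  move/cvgryPge : gy => /(_ (L / mu)) gy.
  near=> t.
  have t0 : 0 < t by near: t; exact: nbhs_pinfty_gt.
  have gt0 := g0 t t0.
  have c0 : 0 < t `^ (a / 2) by rewrite powR_gt0.
  have gL : L <= mu * g t by rewrite mulrC -ler_pdivrMr//; near: t.
  have gd : mu * g t <= d * t `^ (a / 2).
    have : `|0 - g t / t `^ (a / 2)| <= d / mu by near: t.
    rewrite sub0r normrN gtr0_norm ?divr_gt0// ler_pdivrMr// mulrAC ler_pdivlMr//.
    by rewrite mulrC.
  apply/andP; split.
    apply: mule_ge0; last exact: Lnorm_ge0.
    by rewrite lee_fin; case: (p) => [r||] //=; exact: powR_ge0.
  rewrite -[e in leRHS](@divfK _ (1 + 2 * mu)) ?gt_eqF//.
  apply: LpNormOn_le => //; first exact: ltW.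
    by move=> x /= /andP[_]; rewrite ltr_pdivrMr// => /ltW.
  move=> x /= /andP[_]; rewrite ltr_pdivrMr// => /ltW xg.
  apply: HL => //; first exact: le_trans gd.
  exact: le_trans gd.
(* Convergence of extended reals: eventual finiteness, from [main] at e = 1, and then convergence of
   the real values. *)
apply/fine_cvgP; split.
  near=> t; have /andP[h0 h1] : (0 <= (inv_p_pow (g t) p)%:E *
     LpNormOn p [set x | (nu < `|x| / g t < mu)%R]
       (fun x => t `^ (a / 2) * mild_sol a u0 x t - M * profileF a 0)%R <= 1%:E)%E.
    by near: t; exact: main.
  by rewrite ge0_fin_numE// (le_lt_trans h1)// ltry.
apply/cvgrPdist_le => e e0; near=> t.
have /andP[h0 h1] : (0 <= (inv_p_pow (g t) p)%:E *
     LpNormOn p [set x | (nu < `|x| / g t < mu)%R]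
       (fun x => t `^ (a / 2) * mild_sol a u0 x t - M * profileF a 0)%R <= e%:E)%E.
  by near: t; exact: main.
rewrite sub0r normrN /= ger0_norm ?fine_ge0// -lee_fin fineK//.
by rewrite ge0_fin_numE// (le_lt_trans h1)// ltry.
Unshelve. all: by end_near. Qed.
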